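(* Let $\alpha\in(0,1)$. Let $B$ be a random variable having the beta distribution $B(\alpha,1-\alpha)$, and let $Y$ be a random variable with values in $\{1,2,3,\ldots\}$ such that, conditionally on $B=p$, $Y$ has the geometric distribution $$\mathbb{P}(Y=k\mid B=p)=p(1-p)^{k-1},\qquad k=1,2,3,\ldots$$ Then, unconditionally, $Y$ has the Sibuya distribution with parameter $\alpha$.
   Context: The beta distribution $B(\alpha,1-\alpha)$, $\alpha\in(0,1)$, is the probability distribution on $(0,1)$ with density $f_\alpha(x)=\dfrac{x^{\alpha-1}(1-x)^{-\alpha}}{\Gamma(\alpha)\,\Gamma(1-\alpha)}$ for $x\in(0,1)$ and $f_\alpha(x)=0$ otherwise. The Sibuya distribution with parameter $\alpha\in(0,1)$ is the distribution on $\{1,2,3,\ldots\}$ with probability mass function $$\mathbb{P}(Y=k)=(-1)^{k+1}\binom{\alpha}{k}=(-1)^{k+1}\frac{\alpha(\alpha-1)\cdots(\alpha-k+1)}{k!},\qquad k=1,2,3,\ldots$$ *)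

(* Defs.v *)
From HB Require Import structures.
From mathcomp Require Import all_boot all_order all_algebra.
From mathcomp Require Import all_classical all_reals all_analysis.

Set Implicit Arguments.
Unset Strict Implicit.
Unset Printing Implicit Defensive.

Import Order.TTheory GRing.Theory Num.Theory.
Import numFieldNormedType.Exports.

Local Open Scope classical_set_scope.
Local Open Scope ring_scope.

(* Euler's integral, which converges exactly when 0 < s (for s <= 0 the value
   is the [fine] of +oo, i.e., 0). *)
Definition gamma_fun {R : realType} (s : R) : R :=
  \int[lebesgue_measure]_(x in `]0, +oo[) (x `^ (s - 1) * expR (- x)).

(* Density of the beta distribution B(a, 1 - a). The library's [beta_pdf] only
   covers natural number parameters. *)
Definition beta_compl_pdf {R : realType} (a x : R) : R :=
  if 0 < x < 1 then
    x `^ (a - 1) * (1 - x) `^ (- a) / (gamma_fun a * gamma_fun (1 - a))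
  else 0.

Definition geometric_pmf {R : realType} (p : R) (k : nat) : R :=
  if k is j.+1 then p * (1 - p) ^+ j else 0.

Definition gen_binomial {R : realType} (a : R) (k : nat) : R :=
  (\prod_(i < k) (a - i%:R)) / k`!%:R.

Definition sibuya_pmf {R : realType} (a : R) (k : nat) : R :=
  if k is 0%N then 0 else (-1) ^+ k.+1 * gen_binomial a k.

Definition has_pdf {d : measure_display} {T : measurableType d} {R : realType}
    (P : probability T R) (X : {RV P >-> R}) (f : R -> R) : Prop :=
  measurable_fun setT f /\
  forall A : set R, measurable A ->
    distribution P X A = (\int[lebesgue_measure]_(x in A) (f x)%:E)%E.

Definition has_pmf {d : measure_display} {T : measurableType d} {R : realType}
    (P : probability T R) (Y : {RV P >-> nat}) (f : nat -> R) : Prop :=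
  forall k : nat, P (Y @^-1` [set k]) = (f k)%:E.

(* [g x k] is a version of P(Y = k | X = x), in the sense of regular conditional
   distributions: x |-> g x k is measurable and
     P(X \in A, Y = k) = \int_A g x k dP_X(x)   for all Borel sets A.
   This constrains g only up to P_X-null sets of x. *)
Definition has_cond_pmf {d : measure_display} {T : measurableType d}
    {R : realType} (P : probability T R) (X : {RV P >-> R})
    (Y : {RV P >-> nat}) (g : R -> nat -> R) : Prop :=
  (forall k : nat, measurable_fun setT (fun x => g x k)) /\
  forall (A : set R) (k : nat), measurable A ->
    P (X @^-1` A `&` Y @^-1` [set k]) =
    (\int[distribution P X]_(x in A) (g x k)%:E)%E.

(* Main.v *)
Require Import Defs.
From HB Require Import structures.
From mathcomp Require Import all_boot all_order all_algebra.
From mathcomp Require Import all_classical all_reals all_analysis.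
From mathcomp Require Import measurable_realfun.
From mathcomp Require Import ring lra.

Import Order.TTheory GRing.Theory Num.Theory.
Import numFieldNormedType.Exports.

Local Open Scope classical_set_scope.
Local Open Scope ring_scope.

(** Write m_j for E[(1 - B)^j; 0 < B < 1] and p_j for E[B (1 - B)^j; 0 < B < 1],
    where B has the beta law B(a, 1 - a).  Conditioning on B gives
    P(Y = j + 1) = p_j, and m_j is P(Y > j).  Three relations determine both
    sequences:
    - m_0 = 1, because B is almost surely in (0, 1).  The normalising constant
      1 / (Gamma(a) Gamma(1 - a)) is thus never evaluated: having total mass 1
      is all that is needed of it.
    - m_(j+1) = m_j - p_j, because (1 - x)^(j+1) = (1 - x)^j - x (1 - x)^j
      ([Rintegral_survS]).
    - a m_(j+1) = (j + 1 - a) p_j ([Rintegral_surv_geom]), which is integration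
      by parts: the derivative of x^a (1 - x)^(j+1-a) is
      a x^(a-1) (1 - x)^(j+1-a) - (j + 1 - a) x^a (1 - x)^(j-a),
      and that primitive vanishes at both ends of [0, 1].
    The last two yield p_j = a m_j / (j + 1) and
    p_(j+1) / p_j = (j + 1 - a) / (j + 2), the recurrence satisfied by the Sibuya
    probabilities ([sibuya_pmfE]).

    Both integrands of the integration by parts may be unbounded at the ends of
    (0, 1).  They are however nonnegative, so the identity on compact
    subintervals passes to the limit by monotone convergence
    ([integral_itvoo_derive]), as an equality in the extended reals that
    does not presuppose integrability over (0, 1).  Expectations under the law of B are turned into
    Lebesgue integrals by the Radon-Nikodym theorem
    ([integral_distribution_pdf]). *)

(** * Integration by parts on an open interval *)

(** The fundamental theorem of calculus for F' = u - v on a compact subinterval,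
    stated without subtraction of integrals so that both sides have limits when
    the subinterval grows. *)
Lemma integral_itvcc_derive (R : realType) (F u v : R -> R) (a b x y : R) :
  a < x -> x < y -> y < b ->
  {in `]a, b[, continuous u} -> {in `]a, b[, continuous v} ->
  {in `]a, b[, forall z : R, is_derive z 1 F (u z - v z)} ->
  (\int[lebesgue_measure]_(z in `[x, y]) (u z)%:E =
   \int[lebesgue_measure]_(z in `[x, y]) (v z)%:E + (F y - F x)%:E)%E.
Proof.
move=> ax xy yb cu cv dF.
have sub z : z \in `[x, y] -> z \in `]a, b[.
  rewrite !in_itv/= => /andP[xz zy].
  by rewrite (lt_le_trans ax xz) (le_lt_trans zy yb).
have cW (w : R -> R) : {in `]a, b[, continuous w} -> {within `[x, y], continuous w}.
  move=> cw; apply: continuous_in_subspaceT => z.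
  by rewrite inE /= => zxy; apply: cw; exact: sub.
have iW (w : R -> R) : {in `]a, b[, continuous w} ->
    lebesgue_measure.-integrable `[x, y] (EFin \o w).
  move=> cw; apply: continuous_compact_integrable; first exact: segment_compact.
  exact: cW.
have cF z : z \in `[x, y] -> {for z, continuous F}.
  move=> /sub zab; apply: differentiable_continuous; apply/derivable1_diffP.
  by have := dF _ zab.
have FTC : (\int[lebesgue_measure]_(z in `[x, y]) (u z - v z)%:E =
    (F y)%:E - (F x)%:E)%E.
  apply: continuous_FTC2 => //.
  - apply: cW => z zab.
    by apply: cvgB; [exact: cu|exact: cv].
  - split.
    + by move=> z /subset_itv_oo_cc /sub /dF [].
    + by apply: cvg_at_right_filter; apply: cF; rewrite in_itv/= lexx ltW.
    + by apply: cvg_at_left_filter; apply: cF; rewrite in_itv/= lexx ltW.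
  - move=> z /subset_itv_oo_cc /sub /dF Fz.
    by rewrite derive1E derive_val.
have := FTC.
under eq_integral do rewrite EFinB.
rewrite integralB_EFin//; try exact: iW.
rewrite EFinB => <-.
by rewrite addeC subeK// integrable_fin_num//; exact: iW.
Qed.

Lemma itv_oo_bigcup (R : realType) (a b : R) (e := fun n : nat => (b - a) / n.+3%:R) :
  a < b -> `]a, b[%classic = \bigcup_n `[a + e n, b - e n]%classic.
Proof.
move=> ab; have ba : 0 < b - a by rewrite subr_gt0.
apply/seteqP; split => [x /=|x [n _] /=].
  rewrite in_itv/= => /andP[ax xb].
  have ax0 : 0 < x - a by rewrite subr_gt0.
  have xb0 : 0 < b - x by rewrite subr_gt0.
  pose t := Num.min ((x - a) / (b - a)) ((b - x) / (b - a)).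
  have t0 : 0 < t by rewrite lt_min !divr_gt0.
  (* for this n, e n = (b - a) / n.+3 is at most both x - a and b - x *)
  exists (Num.truncn t^-1) => //=.
  rewrite in_itv/=.
  have : e (Num.truncn t^-1) <= t * (b - a).
    rewrite /e mulrC ler_pM2r// invf_ple ?posrE//.
    rewrite ltW// (lt_le_trans (truncnS_gt _))// ler_nat.
    by rewrite ltnS -addn2 leq_addr.
  have : t * (b - a) <= x - a by rewrite -ler_pdivlMr// ge_min lexx.
  have : t * (b - a) <= b - x by rewrite -ler_pdivlMr// ge_min lexx orbT.
  lra.
rewrite !in_itv/=.
have : 0 < e n by rewrite divr_gt0.
lra.
Qed.

(** If F' = u - v with u and v nonnegative and F has the same limit at both ends
    of ]a, b[, then u and v have the same integral, possibly infinite. *)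
Lemma integral_itvoo_derive (R : realType) (F u v : R -> R) (a b l : R) :
  a < b ->
  {in `]a, b[, continuous u} -> {in `]a, b[, continuous v} ->
  {in `]a, b[, forall x, 0 <= u x} -> {in `]a, b[, forall x, 0 <= v x} ->
  {in `]a, b[, forall x : R, is_derive x 1 F (u x - v x)} ->
  F x @[x --> a^'+] --> l -> F x @[x --> b^'-] --> l ->
  (\int[lebesgue_measure]_(x in `]a, b[) (u x)%:E =
   \int[lebesgue_measure]_(x in `]a, b[) (v x)%:E)%E.
Proof.
move=> ab cu cv u0 v0 dF Fa Fb.
have ba : 0 < b - a by rewrite subr_gt0.
pose e n : R := (b - a) / n.+3%:R.
pose D n := `[a + e n, b - e n]%classic.
have e0 n : 0 < e n by rewrite divr_gt0.
have eS m n : (m <= n)%N -> e n <= e m.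
  by move=> mn; rewrite ler_pM2l// lef_pV2 ?posrE// ler_nat.
have e_lt n : a + e n < b - e n.
  suff : e n * 3%:R <= b - a by have := e0 n; lra.
  by rewrite mulrAC ler_pdivrMr// ler_pM2l// ler_nat.
have e_cvg : e n @[n --> \oo] --> 0.
  rewrite -(mulr0 (b - a)); apply: cvgM; first exact: cvg_cst.
  by have := @cvg_harmonic R; rewrite -(cvg_shiftn 2); under eq_fun do rewrite addn2.
have subD n : D n `<=` `]a, b[.
  by rewrite /D itv_oo_bigcup//; exact: (@bigcup_sup _ _ n).
have ndD : nondecreasing_seq D.
  move=> m n mn; apply/subsetPset => x; rewrite /D/= !in_itv/=.
  by have := eS _ _ mn; lra.
have lim (w : R -> R) : {in `]a, b[, continuous w} ->
    {in `]a, b[, forall x, 0 <= w x} ->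
    (\int[lebesgue_measure]_(x in D n) (w x)%:E @[n --> \oo] -->
     \int[lebesgue_measure]_(x in `]a, b[) (w x)%:E)%E.
  move=> cw w0; rewrite itv_oo_bigcup//.
  apply: ge0_nondecreasing_set_cvg_integral => // n.
  - exact: measurable_itv.
  - apply/measurable_EFinP; apply: (measurable_funS _ (@subD n)) => //.
    apply: open_continuous_measurable_fun; first exact: interval_open.
    by move=> x; rewrite inE; exact: cw.
  - by move=> x /(subD n) xab; rewrite lee_fin; exact: w0.
(* the boundary term, which vanishes in the limit *)
pose r n := (F (b - e n) - F (a + e n))%:E.
have r0 : (r n @[n --> \oo] --> 0%:E)%E.
  apply: cvg_EFin; first by apply: nearW.
  rewrite -(subrr l); apply: cvgB.
    have /cvg_at_leftP := Fb; apply; split.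
      by move=> n; rewrite ltrBlDr ltrDl.
    by rewrite -[X in _ --> X]subr0; apply: cvgB => //; exact: cvg_cst.
  have /cvg_at_rightP := Fa; apply; split.
    by move=> n; rewrite ltrDl.
  by rewrite -[X in _ --> X]addr0; apply: cvgD => //; exact: cvg_cst.
have := lim _ cu u0.
have -> : (fun n => \int[lebesgue_measure]_(x in D n) (u x)%:E)%E =
   (fun n => \int[lebesgue_measure]_(x in D n) (v x)%:E + r n)%E.
  apply/funext => n; apply: integral_itvcc_derive (cu) (cv) dF => //.
    by rewrite ltrDl.
  by rewrite ltrBlDr ltrDl.
have v_lim : ((\int[lebesgue_measure]_(x in D n) (v x)%:E + r n) @[n --> \oo] -->
     \int[lebesgue_measure]_(x in `]a, b[) (v x)%:E)%E.
  rewrite -[X in _ --> X]adde0; apply: cvgeD => //; last exact: lim.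
  by rewrite fin_num_adde_defl.
by move=> /(cvg_lim (@ereal_hausdorff R)) <-; exact/cvg_lim.
Qed.

(** * The recurrence between beta integrals *)

Lemma powR_continuous (R : realType) (p x : R) : 0 < x ->
  {for x, continuous (@powR R ^~ p)}.
Proof.
move=> x0; apply: differentiable_continuous; apply/derivable1_diffP.
by have [] := is_derive1_powR p x0.
Qed.

Lemma powR_1B_continuous (R : realType) (p x : R) : x < 1 ->
  {for x, continuous (fun y : R => (1 - y) `^ p)}.
Proof.
move=> x1; apply: (@continuous_comp _ _ _ (fun y : R => 1 - y) (@powR R ^~ p)).
  by apply: cvgB; [exact: cvg_cst|exact: cvg_id].
by apply: powR_continuous; rewrite subr_gt0.
Qed.

(** p B(p, q + 1) = q B(p + 1, q) for the Euler beta function B. *)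
Lemma integral_beta_rec (R : realType) (p q : R) : 0 < p -> 0 < q ->
  (\int[lebesgue_measure]_(x in `]0%R, 1%R[) (p * (x `^ (p - 1) * (1 - x) `^ q))%:E =
   \int[lebesgue_measure]_(x in `]0%R, 1%R[) (q * (x `^ p * (1 - x) `^ (q - 1)))%:E)%E.
Proof.
move=> p0 q0.
have cont r s c : {in `]0, 1[, continuous (fun x : R => c * (x `^ r * (1 - x) `^ s))}.
  move=> x; rewrite in_itv/= => /andP[x0 x1].
  apply: cvgM; first exact: cvg_cst.
  by apply: cvgM; [exact: powR_continuous|exact: powR_1B_continuous].
apply: (@integral_itvoo_derive _ (fun x : R => x `^ p * (1 - x) `^ q) _ _ _ _ 0) => //.
- by move=> x _; rewrite !mulr_ge0 ?powR_ge0// ltW.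
- by move=> x _; rewrite !mulr_ge0 ?powR_ge0// ltW.
- move=> x; rewrite in_itv/= => /andP[x0 x1].
  have x1' : 0 < 1 - x by rewrite subr_gt0.
  have d1 := is_derive1_powR p x0.
  have d2 : is_derive x 1 (fun y : R => 1 - y) (-1).
    rewrite -(sub0r 1); exact: (is_deriveB (is_derive_cst _ _ _) (is_derive_id _ _)).
  have d3 := @is_derive1_comp _ (@powR R ^~ q) (fun y : R => 1 - y) _ _ _
    (is_derive1_powR q x1') d2.
  apply: (@is_derive_eq _ _ _ _ _ _ _ _ (is_deriveM d1 d3)).
  by rewrite /= /GRing.scale/=; ring.
- rewrite -[X in _ --> X](mul0r ((1 - 0) `^ q)); apply: cvgM.
    exact: (powR_cvg0 p0).
  by apply: cvg_at_right_filter; apply: powR_1B_continuous.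
- rewrite -[X in _ --> X](mulr0 (1 `^ p)); apply: cvgM.
    by apply: cvg_at_left_filter; apply: powR_continuous.
  apply/cvg_at_leftP => w [w1 wc].
  have /cvg_at_rightP/(_ (fun n => 1 - w n)) := powR_cvg0 q0; apply; split.
    by move=> n; rewrite subr_gt0.
  by rewrite -[X in _ --> X](subrr 1); apply: cvgB => //; exact: cvg_cst.
Qed.

(** * Expectations under a density *)

(** E[g(X); X \in U] is the integral of g against the density of X. *)
Lemma integral_distribution_pdf (d : measure_display) (T : measurableType d)
    (R : realType) (P : probability T R) (X : {RV P >-> R}) (f : R -> R)
    (U : set R) (g : R -> \bar R) :
  has_pdf X f -> measurable U -> measurable_fun setT g ->
  P.-integrable (X @^-1` U) (g \o X) ->
  (\int[distribution P X]_(x in U) g x =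
   \int[lebesgue_measure]_(x in U) (g x * (f x)%:E))%E.
Proof.
move=> [mf Pf] mU mg ig.
(* The Lebesgue measure lives on [measurableTypeR R], which has the same
   measurable sets as R but a different display; X' is X viewed with values
   there. *)
have mX : @measurable_fun _ _ T (measurableTypeR R) setT X.
  exact: (measurable_funPT X).
pose X' : {mfun T >-> measurableTypeR R} :=
  @mfun_Sub _ _ T (measurableTypeR R) X (mem_set mX).
have -> : (\int[distribution P X]_(x in U) g x =
           \int[distribution P X']_(x in U) g x)%E.
  by rewrite !integral_pushforward.
have ig' : (distribution P X').-integrable U g by exact: integrable_pushforward.
have {}Pf A : measurable A ->
    distribution P X' A = (\int[lebesgue_measure]_(x in A) (f x)%:E)%E.
  by move=> mA; rewrite -Pf.
(* f is almost everywhere the Radon-Nikodym derivative of the law of X *)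
have dom : distribution P X' `<< @lebesgue_measure R.
  apply/null_content_dominatesP => A mA A0.
  rewrite Pf//; apply: null_set_integral => //.
  by apply/measurable_EFinP; exact: measurable_funTS.
rewrite -(Radon_Nikodym_change_of_variables dom)//=.
apply: ae_eq_integral => //.
- apply: emeasurable_funM; first exact: measurable_funTS.
  apply: (measurable_int (@lebesgue_measure R)).
  apply: (integrableS _ _ (@subsetT _ _)) => //=.
  by apply: Radon_Nikodym_integrable; exact: dom.
- apply: emeasurable_funM; first exact: measurable_funTS.
  by apply/measurable_EFinP; exact: measurable_funTS.
- apply: ae_eqe_mul2l => /=.
  rewrite Radon_NikodymE; case: cid => /= h [h1 h2 h3].
  apply: integral_ae_eq => //=.
  + exact: integrableS h2.
  + by apply/measurable_EFinP; exact: measurable_funTS.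
  + by move=> E EU mE; rewrite -h3// Pf.
Qed.

(** * The Sibuya recurrence *)

(** With p the mass function of Y shifted by one and m its survival function,
    the last hypothesis says that
    a P(Y > j + 1) = (j + 1 - a) P(Y = j + 1); the proof first deduces
    (j + 1) P(Y = j + 1) = a P(Y > j). *)
Lemma sibuya_pmfE (R : realType) (a : R) (m p : nat -> R) :
  m 0%N = 1 -> (forall j, m j.+1 = m j - p j) ->
  (forall j, a * m j.+1 = (j.+1%:R - a) * p j) ->
  forall j, p j = sibuya_pmf a j.+1.
Proof.
move=> m0 mS rec.
have pm j : j.+1%:R * p j = a * m j.
  by have := rec j; rewrite mS mulrBl mulrBr => /eqP; rewrite subr_eq => /eqP ->; ring.
have j0 (j : nat) : j.+1%:R != 0 :> R by rewrite pnatr_eq0.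
elim=> [|j IH].
  have := pm 0%N; rewrite mul1r m0 mulr1 => ->.
  rewrite /sibuya_pmf /gen_binomial big_ord_recl big_ord0 /=.
  by rewrite factS fact0 divr1; ring.
have -> : p j.+1 = - p j * (a - j.+1%:R) / j.+2%:R.
  apply: (mulfI (j0 j.+1)); rewrite pm rec.
  by rewrite [RHS]mulrC divfK//; ring.
rewrite IH /sibuya_pmf /gen_binomial [in RHS]big_ord_recr/= [in RHS]factS.
rewrite natrM !exprS; move: ((-1) ^+ j) => s; field.
by rewrite -(natrD _ 2 j) j0 pnatr_eq0 -lt0n fact_gt0.
Qed.

(** * Geometric laws mixed over a beta law *)

Lemma gamma_fun_ge0 (R : realType) (s : R) : 0 <= gamma_fun s.
Proof.
by apply: Rintegral_ge0 => x _; rewrite mulr_ge0 ?powR_ge0 ?expR_ge0.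
Qed.

Section beta_geometric_mixture.
Variables (R : realType) (d : measure_display) (T : measurableType d).
Variables (P : probability T R) (alpha : R) (B : {RV P >-> R}).
Hypotheses (alpha_gt0 : 0 < alpha) (alpha_lt1 : alpha < 1).
Hypothesis B_beta : has_pdf B (beta_compl_pdf alpha).

Local Notation mu := (distribution P B).
Local Notation I := (`]0%R, 1%R[%classic : set R).

Let mI : measurable I. Proof. exact: measurable_itv. Qed.

Lemma distribution_beta_itv : mu I = 1%E.
Proof.
have mu1 : mu setT = 1%E by exact: probability_setT.
rewrite -mu1; case: B_beta => _ Pf.
rewrite Pf// Pf// integral_mkcond; apply: eq_integral => x _.
rewrite patchE; case: ifPn => // /negP xI.
rewrite /beta_compl_pdf; case: ifPn => // x01; case: xI.
by rewrite inE/= in_itv.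
Qed.

Lemma integrable_bounded_itv (M : R) (g : R -> R) : measurable_fun setT g ->
  {in `]0, 1[, forall x, `|g x| <= M} ->
  P.-integrable (B @^-1` I) (fun w => (g (B w))%:E).
Proof.
move=> mg gM; apply: measurable_bounded_integrable => //.
- exact: measurable_funPTI.
- by rewrite (@le_lt_trans _ _ 1%E) ?probability_le1 ?ltry//; exact: measurable_funPTI.
- by apply: measurable_funTS; exact: measurableT_comp.
- exists M; split; first exact: num_real.
  by move=> N MN w wI; exact: le_trans (gM _ wI) (ltW MN).
Qed.

Lemma integrable_distribution_itv (M : R) (g : R -> R) : measurable_fun setT g ->
  {in `]0, 1[, forall x, `|g x| <= M} -> mu.-integrable I (EFin \o g).
Proof.
move=> mg gM; apply: integrable_pushforward => //.
  exact/measurable_EFinP.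
exact: integrable_bounded_itv gM.
Qed.

(** P(Y > j) and P(Y = j + 1) for Y geometric of parameter x. *)
Let surv j (x : R) := (1 - x) ^+ j.
Let geom j (x : R) := geometric_pmf x j.+1.

Let m_surv j : measurable_fun setT (surv j).
Proof. by apply: measurable_funX; exact: measurable_funB. Qed.

Let m_geom j : measurable_fun setT (geom j).
Proof. by apply: measurable_funM => //; exact: m_surv. Qed.

Let surv_itv j x : x \in `]0, 1[ -> 0 <= surv j x <= 1.
Proof.
rewrite in_itv/= => /andP[x0 x1].
by rewrite exprn_ge0/= ?exprn_ile1//; lra.
Qed.

Let surv_le1 j x : x \in `]0, 1[ -> `|surv j x| <= 1.
Proof. by move=> /(surv_itv j) /andP[s0 s1]; rewrite ger0_norm. Qed.

Let geom_le1 j x : x \in `]0, 1[ -> `|geom j x| <= 1.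
Proof.
move=> xI; have /andP[s0 s1] := surv_itv j _ xI.
move: xI; rewrite in_itv/= => /andP[x0 x1].
by rewrite ger0_norm ?mulr_ge0 ?mulr_ile1 // ltW.
Qed.

Let i_surv j : mu.-integrable I (EFin \o surv j).
Proof. exact: integrable_distribution_itv (surv_le1 j). Qed.

Let i_geom j : mu.-integrable I (EFin \o geom j).
Proof. exact: integrable_distribution_itv (geom_le1 j). Qed.

Lemma Rintegral_surv0 : \int[mu]_(x in I) surv 0 x = 1.
Proof.
rewrite /Rintegral (eq_integral (cst 1%E))//.
by rewrite integral_cst// mul1e; exact: (congr1 fine distribution_beta_itv).
Qed.

Lemma Rintegral_survS j :
  \int[mu]_(x in I) surv j.+1 x =
  \int[mu]_(x in I) surv j x - \int[mu]_(x in I) geom j x.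
Proof.
rewrite -RintegralB//; apply: eq_Rintegral => x _.
by rewrite /surv /geom /= exprS mulrBl mul1r.
Qed.

Let measurable_powRM (c r s : R) :
  measurable_fun I (fun x => (c * (x `^ r * (1 - x) `^ s))%:E).
Proof.
apply/measurable_EFinP/measurable_funTS; apply: measurable_funM => //.
apply: measurable_funM => //.
apply: (@measurableT_comp _ _ _ _ _ _ (@powR R ^~ s)) => //.
exact: measurable_funB.
Qed.

(** The integration by parts, for the exponents p = alpha and
    q = j + 1 - alpha, which are both positive. *)
Lemma Rintegral_surv_geom j :
  alpha * \int[mu]_(x in I) surv j.+1 x =
  (j.+1%:R - alpha) * \int[mu]_(x in I) geom j x.
Proof.
rewrite -!RintegralZl// /Rintegral; congr fine.
(* both sides become Lebesgue integrals against the density of B *)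
have chg c (g : R -> R) : measurable_fun setT g ->
    {in `]0, 1[, forall x, `|g x| <= 1} ->
    (\int[mu]_(x in I) (c * g x)%:E =
     \int[lebesgue_measure]_(x in I) ((c * g x)%:E * (beta_compl_pdf alpha x)%:E))%E.
  move=> mg g1; apply: integral_distribution_pdf => //.
    by apply/measurable_EFinP; exact: measurable_funM.
  apply: (@integrable_bounded_itv `|c| (fun x => c * g x)).
    exact: measurable_funM.
  by move=> x xI; rewrite normrM ler_piMr// g1.
rewrite !chg//; [|exact: geom_le1|exact: surv_le1].
set C := (gamma_fun alpha * gamma_fun (1 - alpha))^-1.
have C0 : 0 <= C by rewrite invr_ge0 mulr_ge0 ?gamma_fun_ge0.
pose q := j.+1%:R - alpha.
have q0 : 0 < q by rewrite subr_gt0 (lt_le_trans alpha_lt1)// ler1n.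
have powE x (n : nat) : x < 1 ->
    (1 - x) `^ (n%:R - alpha) = (1 - x) ^+ n * (1 - x) `^ (- alpha).
  move=> x1; have x1' : 0 < 1 - x by rewrite subr_gt0.
  rewrite powRD ?(gt_eqF x1') ?implybT//.
  by rewrite powR_mulrn// ltW.
transitivity (C%:E * \int[lebesgue_measure]_(x in I)
    (alpha * (x `^ (alpha - 1) * (1 - x) `^ q))%:E)%E.
  rewrite -ge0_integralZl_EFin//; last 2 first.
  - by move=> x _; rewrite lee_fin !mulr_ge0 ?powR_ge0// ltW.
  - exact: measurable_powRM.
  apply: eq_integral => x; rewrite inE/= in_itv/= => x01; have /andP[x0 x1] := x01.
  rewrite -!EFinM; congr EFin.
  by rewrite /beta_compl_pdf x01 -/C /surv /q powE//; ring.
rewrite integral_beta_rec// -ge0_integralZl_EFin//; last 2 first.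
- by move=> x _; rewrite lee_fin !mulr_ge0 ?powR_ge0// ltW.
- exact: measurable_powRM.
apply: eq_integral => x; rewrite inE/= in_itv/= => x01; have /andP[x0 x1] := x01.
rewrite -!EFinM; congr EFin.
have -> : q - 1 = j%:R - alpha by rewrite /q -natr1; ring.
have xE : x `^ alpha = x * x `^ (alpha - 1) by rewrite mulr_powRB1// ltW.
by rewrite /beta_compl_pdf x01 -/C /geom/= powE// xE -/q; ring.
Qed.

(** The conditional law of Y is integrated over ]0, 1[ only, where the geometric
    weights are nonnegative and bounded; the rest is negligible for B. *)
Lemma prob_geom (Y : {RV P >-> nat}) j : has_cond_pmf B Y geometric_pmf ->
  P (Y @^-1` [set j.+1]) = (\int[mu]_(x in I) geom j x)%:E.
Proof.
move=> [_ PY].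
rewrite /Rintegral fineK ?integrable_fin_num//; last exact: i_geom.
have mY : measurable (Y @^-1` [set j.+1]) by exact: measurable_funPTI.
have mB : measurable (B @^-1` I) by exact: measurable_funPTI.
rewrite (measureDI P mY mB) setIC -[RHS](PY I j.+1 mI).
have B0 : P (~` (B @^-1` I)) = 0%E.
  by rewrite probability_setC// [X in (1 - X)%E]distribution_beta_itv subee.
have YB0 : P (Y @^-1` [set j.+1] `\` B @^-1` I) = 0%E.
  apply/eqP; rewrite -measure_le0 -B0; apply: le_measure; last by move=> w [].
    by rewrite inE; exact: measurableD.
  by rewrite inE; exact: measurableC.
exact: (etrans (congr1 (fun z => z + _)%E YB0) (add0e _)).
Qed.

End beta_geometric_mixture.

Theorem theorem1 (R : realType) (d : measure_display) (T : measurableType d)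
    (P : probability T R) (alpha : R) (alpha_gt0 : 0 < alpha)
    (alpha_lt1 : alpha < 1) (B : {RV P >-> R}) (Y : {RV P >-> nat})
    (B_beta : has_pdf B (beta_compl_pdf alpha))
    (Y_ge1 : forall w : T, (1 <= Y w)%N)
    (Y_geom : has_cond_pmf B Y geometric_pmf) :
  has_pmf Y (sibuya_pmf alpha).
Proof.
case=> [|j].
  rewrite [X in P X](_ : _ = set0) ?measure0//.
  by rewrite -subset0 => w /= Yw; have := Y_ge1 w; rewrite Yw.
rewrite (prob_geom _ _ _ _ _ _ B_beta)//; congr EFin.
pose mom j := \int[distribution P B]_(x in `]0, 1[) (1 - x) ^+ j.
pose p j := \int[distribution P B]_(x in `]0, 1[) geometric_pmf x j.+1.
apply: (@sibuya_pmfE _ alpha mom p).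
- exact: (Rintegral_surv0 _ _ _ _ _ _ B_beta).
- exact: (Rintegral_survS _ _ _ _ _).
- exact: (Rintegral_surv_geom _ _ _ _ _ _ alpha_gt0 alpha_lt1 B_beta).
Qed.
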